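(* Let $(M,d)$ be a proper geodesic metric space, $\Gamma$ a finitely generated group, and $\rho:\Gamma\to\mathrm{LHomeo}(M)$ an action with a non-empty compact invariant subset $\Lambda\subset M$, no point of which is isolated in $M$. If $\rho$ is meandering-hyperbolic at $\Lambda$, then $\rho$ is structurally stable in the sense of Lipschitz dynamics: for every action $\rho':\Gamma\to\mathrm{LHomeo}(M)$ sufficiently close to $\rho$ with respect to the compact-open Lipschitz topology, there exist a $\rho'$-invariant subset $\Lambda'\subset M$ and a homeomorphism $\phi:\Lambda\to\Lambda'$ such that $\rho'(g)\circ\phi=\phi\circ\rho(g)$ on $\Lambda$ for all $g\in\Gamma$.
   Context: Conventions: $\mathbb N_0=\{0,1,2,\dots\}$, $\mathbb N=\{1,2,\dots\}$; $B_r(x)$ is the open $r$-ball, $N_r(\Lambda)$ the open $r$-neighborhood. A metric space is proper if its closed balls are compact, geodesic if any two points are joined by an isometrically embedded interval. $\mathrm{LHomeo}(M)$ is the group of homeomorphisms of $M$ whose restrictions to compact subsets are bi-Lipschitz. An action is a homomorphism $\rho:\Gamma\to\mathrm{LHomeo}(M)$. Expansion. Let $f$ be a homeomorphism of $M$, $\lambda>1$, $U\subset M$, $\delta>0$. $f$ is $(\lambda,U)$-expanding if $d(f(x),f(y))\ge\lambda d(x,y)$ for all $x,y\in U$; it is $(\lambda,U;\delta)$-expanding if moreover $B_{\lambda\eta}(f(x))\subset f(B_\eta(x))$ whenever $B_\eta(x)\subset U$ and $\eta\le\delta$. For an open cover $\mathcal U$ of $\Lambda$, $\delta_{\mathcal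 U}$ is the supremum of its Lebesgue numbers (numbers $\delta>0$ such that for every $x\in\Lambda$ the ball $B_\delta(x)$ lies in a member of $\mathcal U$). An action $\rho$ with non-empty compact invariant subset $\Lambda$, no point of which is isolated in $M$, is expanding at $\Lambda$ if there are a finite index set $\mathcal I$, a cover $\mathcal U=\{U_i\mid i\in\mathcal I\}$ of $\Lambda$ by open (possibly empty) subsets of $M$, a map $\mathcal I\to\Gamma$, $i\mapsto s_i$, and real numbers $L\ge\lambda>1$ and $0<\delta\le\delta_{\mathcal U}$ such that for each $i$ the map $\rho(s_i^{-1})$ is $L$-Lipschitz on $N_\delta(\Lambda)$ and $(\lambda,U_i;\delta)$-expanding, and $\Sigma=\{s_i\mid i\in\mathcal I\}$ is a symmetric generating set of $\Gamma$. Then $\mathcal D=(\mathcal I,\mathcal U,\Sigma,\delta,L,\lambda)$ is an expansion datum of $\rho$; $d_\Sigma$ is the word metric on $\Gamma$. Codes and rays. Let $x\in\Lambda$, $0<\eta\le\delta$. For $\alpha:\mathbb N_0\to\mathcal I$ put $p_0=x$, $p_{k+1}=\rho(s_{\alpha(k)}^{-1})(p_k)$. $\alpha$ is a $(\mathcal D,\eta)$-code for $x$ if $B_\eta(p_k)\subset U_{\alpha(k)}$ for every $k\in\mathbb N$ (nothing is required for $k=0$). Its ray is $c^\alpha:\mathbb N_0\to\Gamma$, $c^\alpha_k=s_{\alpha(0)}s_{\alpha(1)}\cdots s_{\alpha(k)}$. $\mathrm{Ray}_x(\mathcal D,\eta)$ is the set of rays of all $(\mathcal D,\eta)$-codes for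 $x$. Refinement. For expansion data $\mathcal D_k=(\mathcal I_k,\mathcal U_k,\Sigma_k,\delta_k,L_k,\lambda_k)$, $k=0,1$, of $\rho$, write $\mathcal D_0\prec\mathcal D_1$ ($\mathcal D_1$ is a refinement of $\mathcal D_0$) if $\mathcal I_0\subset\mathcal I_1$, $U_{0,i}\subset U_{1,i}$ and $s_{0,i}=s_{1,i}$ for all $i\in\mathcal I_0$, $\delta_0>\delta_1$, $L_0\le L_1$, $\lambda_0\ge\lambda_1$. Then for $\eta\le\delta_1$, $\mathrm{Ray}_x(\mathcal D_0,\eta)\subset\mathrm{Ray}_x(\mathcal D_1,\eta)$; also rays shrink the condition: $\mathrm{Ray}_x(\mathcal D,\eta)\subset\mathrm{Ray}_x(\mathcal D,\eta')$ for $\eta'\le\eta$. Equivalence. For $N\in\mathbb N_0$, write $c^\alpha\approx^N_{(\mathcal D,\eta)}c^\beta$ for $c^\alpha,c^\beta\in\mathrm{Ray}_x(\mathcal D,\eta)$ if there are infinite subsets $P,Q\subset\mathbb N_0$ such that $\{c^\alpha_k\mid k\in P\}$ and $\{c^\beta_j\mid j\in Q\}$ are within Hausdorff distance $N$ in $(\Gamma,d_\Sigma)$. $(\mathcal D,\eta;N)$-equivalence is the equivalence relation on $\mathrm{Ray}_x(\mathcal D,\eta)$ generated by $\approx^N_{(\mathcal D,\eta)}$. Meandering hyperbolicity. $\rho$ is meandering-hyperbolic at $\Lambda$ if there are an expansion datum $\mathcal D_0$ (with constant $\delta_0$), a refinement $\mathcal D\succ\mathcal D_0$ (with constant $\delta$)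 and an integer $N\ge1$ such that for every $x\in\Lambda$ all rays in $\mathrm{Ray}_x(\mathcal D_0,\delta_0)$ are $(\mathcal D,\delta;N)$-equivalent (as rays in $\mathrm{Ray}_x(\mathcal D,\delta)$). Closeness. For a compact $K\subset M$ and $f,g\in\mathrm{LHomeo}(M)$ let $d_{\mathrm{Lip},K}(f,g)=\sup_{x\in K}d(f(x),g(x))+\sup_{x\ne y\in K}\left|\frac{d(f(x),f(y))}{d(x,y)}-\frac{d(g(x),g(y))}{d(x,y)}\right|$. The compact-open Lipschitz topology is generated by the sets $\{g\mid d_{\mathrm{Lip},K}(f,g)<\epsilon\}$. ''For every $\rho'$ sufficiently close to $\rho$'' means: there are a compact $K\supset\Lambda$ and $\epsilon>0$ such that the assertion holds for every action $\rho'$ with $d_{\mathrm{Lip},K}(\rho(s_i),\rho'(s_i))<\epsilon$ for all $i\in\mathcal I$, where $\{s_i\}_{i\in\mathcal I}$ are the generators of the expansion datum $\mathcal D$. *)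

(* Defs.v *)
From Stdlib Require Import Relation_Operators.
From HB Require Import structures.
From mathcomp Require Import all_boot all_order all_algebra.
From mathcomp Require Import all_classical all_reals all_analysis.

Set Implicit Arguments.
Unset Strict Implicit.
Unset Printing Implicit Defensive.

Import Order.TTheory GRing.Theory Num.Theory.

Local Open Scope classical_set_scope.
Local Open Scope ring_scope.

Section Metric.
Context {R : realType} {M : metricType R}.
Implicit Types (x y : M) (A B K U Lam : set M) (f g : M -> M).

(* [closed_ball] of the library is the closure of the open ball, which may be
   strictly smaller than the closed ball. *)
Definition proper_space : Prop :=
  forall x (r : R), compact [set y | mdist x y <= r].

Definition geodesic_space : Prop :=
  forall x y, exists c : R -> M, [/\ c 0 = x, c (mdist x y) = y &
    forall s t : R, s \in `[0, mdist x y] -> t \in `[0, mdist x y] ->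
      mdist (c s) (c t) = `|s - t|].

Definition nbhd (r : R) A : set M := \bigcup_(x in A) ball x r.

Definition klipschitz_in (k : R) A f : Prop :=
  forall x y, A x -> A y -> mdist (f x) (f y) <= k * mdist x y.

Definition bilipschitz_in A f : Prop :=
  exists2 k : R, 0 < k & forall x y, A x -> A y ->
    k^-1 * mdist x y <= mdist (f x) (f y) <= k * mdist x y.

Definition homeomorphism f : Prop :=
  continuous f /\ exists g, [/\ continuous g, cancel f g & cancel g f].

Definition lhomeo f : Prop :=
  homeomorphism f /\ forall K, compact K -> bilipschitz_in K f.

(* The restriction of f to A is a homeomorphism from A onto B; the values of f
   outside A are irrelevant. *)
Definition homeomorphism_between A B f : Prop :=
  [/\ set_bij A B f, {within A, continuous f} &
    exists g, {in A, cancel f g} /\ {within B, continuous g}].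

Definition expanding (lam : R) U f : Prop :=
  forall x y, U x -> U y -> lam * mdist x y <= mdist (f x) (f y).

Definition expanding_within (lam : R) U (delta : R) f : Prop :=
  expanding lam U f /\
  forall x (eta : R), ball x eta `<=` U -> eta <= delta ->
    ball (f x) (lam * eta) `<=` f @` ball x eta.

Definition lebesgue_number (I : finType) (U : I -> set M) Lam (d : R) : Prop :=
  0 < d /\ forall x, Lam x -> exists i, ball x d `<=` U i.

Definition lebesgue_sup (I : finType) (U : I -> set M) Lam : \bar R :=
  ereal_sup [set d%:E | d in lebesgue_number U Lam].

(* Suprema are taken in [0, +oo]: 0 is adjoined because the second family is
   empty when K is a point. *)
Definition dLip K f g : \bar R :=
  (ereal_sup (0%E |` [set (mdist (f x) (g x))%:E | x in K]) +
   ereal_sup (0%E |` [set r | exists x y, [/\ K x, K y, x <> y &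
     r = `|mdist (f x) (f y) / mdist x y
           - mdist (g x) (g y) / mdist x y|%:E]]))%E.

End Metric.

Arguments proper_space {R} M.
Arguments geodesic_space {R} M.

Section Group.
Context {G : groupType}.
Implicit Types (S : set G) (g h : G).

Definition subgroup (H : set G) : Prop :=
  [/\ H 1%g, forall g h, H g -> H h -> H (g * h)%g & forall g, H g -> H g^-1%g].

Definition generating S : Prop :=
  forall H : set G, subgroup H -> S `<=` H -> H = setT.

Definition symmetric_set S : Prop := forall g, S g -> S g^-1%g.

Definition words S g : set (seq G) :=
  [set w | {in w, forall s, S s} /\ (\prod_(s <- w) s)%g = g].

(* Word metric of a symmetric generating set, in its left-invariant form. *)
Definition word_dist (R : realType) S g h : \bar R :=
  ereal_inf [set (size w)%:R%:E | w in words S (g^-1 * h)%g].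

Definition hausdorff_dist (R : realType) (T : Type) (d : T -> T -> \bar R)
    (A B : set T) : \bar R :=
  maxe (ereal_sup [set ereal_inf [set d a b | b in B] | a in A])
       (ereal_sup [set ereal_inf [set d a b | a in A] | b in B]).

End Group.

Definition finitely_generated (G : groupType) : Prop :=
  exists2 S : set G, finite_set S & generating S.

(* A homomorphism from G to the group of the f with [lhomeo f]; [act] sends 1
   to the identity because its values are bijective. *)
Record lip_action (R : realType) (M : metricType R) (G : groupType) :=
  LipAction {
    act :> G -> M -> M;
    act_lhomeo : forall g, lhomeo (act g);
    actM : forall g h, act (g * h)%g = act g \o act h
  }.

Record datum (R : realType) (M : metricType R) (G : groupType) := Datum {
  idx : finType;
  cov : idx -> set M;
  gen : idx -> G;
  delta : R;
  Lcst : R;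
  lambda : R
}.

Arguments cov {R M G} d i.
Arguments gen {R M G} d i.

Section Dynamics.
Context {R : realType} {M : metricType R} {G : groupType}.
Implicit Types (rho : lip_action M G) (Lam : set M) (D : datum M G).

Definition invariant_set rho Lam : Prop := forall g, rho g @` Lam = Lam.

Record expansion_datum rho Lam D : Prop := ExpansionDatum {
  cov_open : forall i, open (cov D i);
  cov_cover : Lam `<=` \bigcup_i cov D i;
  lambda_gt1 : 1 < lambda D;
  lambda_leL : lambda D <= Lcst D;
  delta_gt0 : 0 < delta D;
  delta_le : ((delta D)%:E <= lebesgue_sup (cov D) Lam)%E;
  gen_lipschitz : forall i,
    klipschitz_in (Lcst D) (nbhd (delta D) Lam) (rho (gen D i)^-1%g);
  gen_expanding : forall i,
    expanding_within (lambda D) (cov D i) (delta D) (rho (gen D i)^-1%g);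
  gen_symmetric : symmetric_set (range (gen D));
  gen_generating : generating (range (gen D))
}.

Fixpoint code_pt rho D (x : M) (a : nat -> idx D) (k : nat) : M :=
  if k is j.+1 then rho (gen D (a j))^-1%g (code_pt rho x a j) else x.

Definition is_code rho D (eta : R) (x : M) (a : nat -> idx D) : Prop :=
  forall k, (0 < k)%N -> ball (code_pt rho x a k) eta `<=` cov D (a k).

Definition ray D (a : nat -> idx D) (k : nat) : G :=
  (\prod_(j < k.+1) gen D (a j))%g.

Definition Ray rho D (eta : R) (x : M) : set (nat -> G) :=
  [set ray a | a in is_code (D := D) rho eta x].

(* The inclusion of index sets is rendered by an injection. *)
Definition refinement D0 D1 : Prop :=
  (exists2 iota : idx D0 -> idx D1, injective iota &
     forall i, cov D0 i `<=` cov D1 (iota i) /\ gen D0 i = gen D1 (iota i)) /\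
  [/\ delta D1 < delta D0, Lcst D0 <= Lcst D1 & lambda D1 <= lambda D0].

Definition ray_close rho D (eta : R) (N : nat) (x : M) (c c' : nat -> G) :=
  [/\ Ray rho D eta x c, Ray rho D eta x c' &
    exists P Q : set nat, [/\ infinite_set P, infinite_set Q &
      (hausdorff_dist (@word_dist G R (range (gen D))) (c @` P) (c' @` Q)
         <= N%:R%:E)%E]].

Definition ray_equiv rho D (eta : R) (N : nat) (x : M) :
    (nat -> G) -> (nat -> G) -> Prop :=
  clos_refl_sym_trans _ (ray_close rho D eta N x).

(* The refined datum D is kept as a parameter since the closeness of actions
   in [structurally_stable_wrt] is measured on its generators; rho is
   meandering-hyperbolic at Lam when this holds for some D. *)
Definition meandering_hyperbolic_wrt rho Lam D : Prop :=
  exists D0, [/\ expansion_datum rho Lam D0, expansion_datum rho Lam D,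
    refinement D0 D &
    exists2 N : nat, (1 <= N)%N &
      forall x, Lam x -> forall c c',
        Ray rho D0 (delta D0) x c -> Ray rho D0 (delta D0) x c' ->
        ray_equiv rho D (delta D) N x c c'].

Definition structurally_stable_wrt rho Lam D : Prop :=
  exists K (eps : R), [/\ compact K, Lam `<=` K, 0 < eps &
    forall rho' : lip_action M G,
      (forall i, dLip K (rho (gen D i)) (rho' (gen D i)) < eps%:E)%E ->
      exists Lam' (phi : M -> M), [/\ invariant_set rho' Lam',
        homeomorphism_between Lam Lam' phi &
        forall g x, Lam x -> rho' g (phi x) = phi (rho g x)]].

End Dynamics.

(* Main.v *)
Require Import Defs.
From mathcomp Require Import all_boot all_order all_algebra.
From mathcomp Require Import all_classical all_reals all_analysis.
From mathcomp Require Import lra.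

(** Shadowing. Let [x] be a point of [Lam] with code [a], ray [c] and orbit
    [p_(k+1) = rho(c_k)^-1 x]. For [k > 0], [rho'(s_(a k))] contracts the ball
    of radius [delta] about [p_(k+1)] by a uniform factor [mu < 1] and sends its
    centre close to [p_k]. Hence exactly one point [y] is such that
    [rho'(c_k)^-1 y] stays within a small [e] of [rho(c_k)^-1 x] for all [k]; it
    is already determined by this closeness up to [delta] for infinitely many
    [k]. If two rays [c], [c'] fellow-travel at distance [N] infinitely often,
    a word of length at most [N] moves the error [e] to at most
    [e (L+1)^N < delta], so [c] and [c'] have the same [y]. Meandering
    hyperbolicity thus makes [phi x = y] independent of the code. Prepending a
    generator to a code gives equivariance. As [phi] is [e]-close to the
    identity, equivariance and expansivity on [Lam] give injectivity. *)

Set Implicit Arguments.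
Unset Strict Implicit.
Unset Printing Implicit Defensive.

Import Order.TTheory GRing.Theory Num.Theory.
Import numFieldNormedType.Exports.

Local Open Scope classical_set_scope.

(** * Distances, the two parts of [dLip], and compact neighborhoods *)

Section Metric.
Local Open Scope ring_scope.
Context {R : realType} {M : metricType R}.
Implicit Types (x y p z : M) (A : set M).

Lemma ballP x (r : R) y : ball x r y <-> mdist x y < r.
Proof. by rewrite ballEmdist. Qed.

(** The adjoined [0%E] makes both suprema non-negative, so a bound on their sum bounds each of
    them. *)
Lemma dLip_lt (K : set M) (f g : M -> M) (eps : R) : (dLip K f g < eps%:E)%E ->
  (forall x, K x -> mdist (f x) (g x) < eps) /\
  (forall x y, K x -> K y -> x <> y ->
     `|mdist (f x) (f y) / mdist x y - mdist (g x) (g y) / mdist x y| < eps).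
Proof.
rewrite /dLip; set A := (X in (ereal_sup X + _)%E).
set B := (X in (_ + ereal_sup X)%E) => AB.
have A0 : (0 <= ereal_sup A)%E by apply: ereal_sup_ubound; left.
have B0 : (0 <= ereal_sup B)%E by apply: ereal_sup_ubound; left.
split=> [x Kx|x y Kx Ky xy]; rewrite -lte_fin; apply: le_lt_trans AB.
  by apply: le_trans (leeDl _ B0); apply: ereal_sup_ubound; right; exists x.
by apply: le_trans (leeDr _ A0); apply: ereal_sup_ubound; right; exists x, y.
Qed.

Lemma mdist_continuous x : continuous (mdist x : M -> R).
Proof.
move=> y; apply/cvgrPdist_lt => r r0; near=> z.
have yz : mdist y z < r.
  apply/ballP; near: z; exact: nbhsx_ballx.
have := metric_triangle x y z; have := metric_triangle x z y.
by rewrite (metric_sym z y) ltr_norml => ? ?; apply/andP; split; lra.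
Unshelve. all: by end_near. Qed.

Lemma closed_mdist_ball x (r : R) : closed [set y | mdist x y <= r].
Proof.
rewrite (_ : [set _ | _] = mdist x @^-1` [set t | t <= r]) //.
by apply: closed_comp => [y _|]; [exact: mdist_continuous|exact: closed_le].
Qed.

Lemma nbhd_sub_compact A (r : R) : proper_space M -> A !=set0 -> compact A ->
  exists2 K, compact K & A `<=` K /\ nbhd r A `<=` K.
Proof.
move=> hp A0 cA; have [x0 Ax0] := A0.
(* The point [c] of [A] farthest from [x0] fixes the radius of a closed ball, compact by
   properness. *)
have [|c _ hc] := compact_EVT_max A0 cA (f := mdist x0).
  by apply: continuous_subspaceT; exact: mdist_continuous.
have xc y : A y -> mdist x0 y <= mdist x0 c.
    by move=> Ay; apply: hc; rewrite inE.
exists [set y | mdist x0 y <= mdist x0 c + `|r|]; first exact: hp.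
split=> [y /xc|z [y /xc ? /ballP yz]] /=; have := ler_norm r.
  by have := normr_ge0 r; lra.
by have := metric_triangle x0 y z; lra.
Qed.

End Metric.

(** * Geometric decay and infinite sets of times *)

Section Numeric.
Local Open Scope ring_scope.
Context {R : realType}.

Lemma expr_small (mu C r : R) : 0 <= mu -> mu < 1 -> 0 < r ->
  exists n0, forall n, (n0 <= n)%N -> mu ^+ n * C < r.
Proof.
move=> mu0 mu1 r0.
have := @cvg_geometric R C mu; rewrite ger0_norm // => /(_ mu1).
move=> /cvgrPdist_lt /(_ r r0)[n0 _ hn]; exists n0 => n /hn /=.
by rewrite sub0r normrN /geometric /= mulrC => /ltr_normlW.
Qed.

Lemma infinite_set_ge (P : set nat) n : infinite_set P ->
  exists2 k, P k & (n <= k)%N.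
Proof.
move=> infP; apply: contrapT => h; apply: infP.
apply: (@sub_finite_set _ _ `I_n); last exact: finite_II.
by move=> k Pk /=; rewrite ltnNge; apply/negP => nk; apply: h; exists k.
Qed.

End Numeric.

(** * Actions, orbits of codes, and existence of codes *)

Section Action.
Local Open Scope ring_scope.
Context {R : realType} {M : metricType R} {G : groupType}.
Implicit Types (rho : lip_action M G) (Lam : set M) (D : datum M G).

Lemma act_inj rho g : injective (rho g).
Proof.
by have [[_ [f [_ fK _]]] _] := act_lhomeo rho g; exact: can_inj fK.
Qed.

Lemma act1 rho x : rho 1%g x = x.
Proof.
apply: (@act_inj rho 1%g).
by rewrite -[LHS]/((rho 1%g \o rho 1%g) x) -actM mulg1.
Qed.

Lemma act_mul rho g h x : rho (g * h)%g x = rho g (rho h x).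
Proof. by rewrite actM. Qed.

Lemma actK rho g : cancel (rho g) (rho g^-1%g).
Proof. by move=> x; rewrite -act_mul mulVg act1. Qed.

Lemma actKV rho g : cancel (rho g^-1%g) (rho g).
Proof. by move=> x; rewrite -act_mul mulgV act1. Qed.

Lemma act_continuous rho g : continuous (rho g).
Proof. by have [[]] := act_lhomeo rho g. Qed.

Lemma act_invariant rho Lam g x : invariant_set rho Lam -> Lam x ->
  Lam (rho g x).
Proof. by move=> inv Lx; rewrite -(inv g); exists x. Qed.

Lemma ray0 D (a : nat -> idx D) : ray a 0 = gen D (a 0%N).
Proof. by rewrite /ray big_ord_recl big_ord0 mulg1. Qed.

Lemma rayS D (a : nat -> idx D) k : ray a k.+1 = (ray a k * gen D (a k.+1))%g.
Proof. by rewrite /ray big_ord_recr. Qed.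

Lemma code_ptS rho D x (a : nat -> idx D) k :
  code_pt rho x a k.+1 = rho (ray a k)^-1%g x.
Proof.
elim: k => [|k IH]; first by rewrite ray0.
by rewrite rayS invgM act_mul -IH.
Qed.

Lemma code_pt_invariant rho Lam D x (a : nat -> idx D) k :
  invariant_set rho Lam -> Lam x -> Lam (code_pt rho x a k).
Proof. by move=> inv Lx; elim: k => //= k; apply: act_invariant. Qed.

(** [delta D] is only bounded by a supremum of Lebesgue numbers. If the claim failed, every member
    of the finite cover would miss a point at distance less than [delta D] from [x]. The maximum of
    these distances is below the supremum, so some Lebesgue number exceeds it, yet the ball of that
    radius lies in no member. *)
Lemma expansion_datum_cover rho Lam D x : expansion_datum rho Lam D -> Lam x ->
  exists i, ball x (delta D) `<=` cov D i.
Proof.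
move=> ED Lx; apply: contrapT => /forallNP h.
have /choice[y hy] : forall i, exists y, mdist x y < delta D /\ ~ cov D i y.
  move=> i; apply: contrapT => /forallNP hi; apply: (h i) => y /ballP xy.
  by apply: contrapT => ny; apply: (hi y).
pose m := \big[Order.max/0]_i mdist x (y i).
have md : m < delta D.
  rewrite /m; elim/big_ind: _ => [|u v ud vd|i _]; first exact: delta_gt0 ED.
    by rewrite gt_max ud.
  by have [] := hy i.
have : (m%:E < lebesgue_sup (cov D) Lam)%E.
  by apply: lt_le_trans (delta_le ED); rewrite lte_fin.
move=> /ereal_sup_gt[_ [d [_ hd] <-]]; rewrite lte_fin => md'.
have [i hi] := hd x Lx; have [_] := hy i; apply; apply/hi/ballP.
by apply: le_lt_trans md'; exact: le_bigmax.
Qed.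

(** The index is chosen from the current orbit point, so the condition holds at time 0 too; this is
    what later allows an index to be prepended. *)
Lemma full_code_exists rho Lam D x : expansion_datum rho Lam D ->
  invariant_set rho Lam -> Lam x -> exists a : nat -> idx D,
    forall k, ball (code_pt rho x a k) (delta D) `<=` cov D (a k).
Proof.
move=> ED inv Lx; have [i0 _] := expansion_datum_cover ED Lx.
have /choice[f hf] : forall p, exists i, Lam p -> ball p (delta D) `<=` cov D i.
  move=> p; have [Lp|] := pselect (Lam p); last by exists i0.
  by have [i hi] := expansion_datum_cover ED Lp; exists i.
pose F p := rho (gen D (f p))^-1%g p.
pose a k := f (iter k F x).
have pt k : code_pt rho x a k = iter k F x by elim: k => //= k ->.
exists a => k; rewrite [a k](_ : _ = f (code_pt rho x a k)) ?pt //.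
by rewrite -pt; apply: hf; exact: code_pt_invariant.
Qed.

End Action.

(** * From Hausdorff distance to connecting words *)

Section WordMetric.
Local Open Scope ring_scope.
Context {R : realType} {G : groupType}.

Lemma hausdorff_dist_word (S : set G) (c c' : nat -> G) (P Q : set nat) N :
  (hausdorff_dist (@word_dist G R S) (c @` P) (c' @` Q)
    <= N%:R%:E)%E ->
  forall j, Q j -> exists k w, [/\ P k, {in w, forall s, S s},
    (size w <= N)%N & c' j = (c k * \prod_(s <- w) s)%g].
Proof.
rewrite /hausdorff_dist ge_max => /andP[_ h] j Qj.
(* Passing to [N.+1] makes the bound strict, so both infima have witnesses; lengths being integers,
   the bound [N] is recovered. *)
have : (ereal_inf [set @word_dist G R S g (c' j) | g in c @` P]
    < N.+1%:R%:E)%E.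
  apply: (@le_lt_trans _ _ N%:R%:E); last by rewrite lte_fin ltr_nat.
  by apply: le_trans h; apply: ereal_sup_ubound; exists (c' j) => //; exists j.
move=> /ereal_inf_lt[_ [_ [k Pk <-] <-]].
move=> /ereal_inf_lt[_ [w [hw pw] <-]]; rewrite lte_fin ltr_nat ltnS => sw.
by exists k, w; rewrite pw mulVKg.
Qed.

End WordMetric.

(** * Estimates for actions close to [rho] *)

Section Perturbation.
Local Open Scope ring_scope.
Context {R : realType} {M : metricType R} {G : groupType}.
Implicit Types (rho : lip_action M G) (Lam : set M) (D : datum M G).

(** Isolates what shadowing needs from closeness: the first two fields serve to pull points back
    along a code, the third to carry errors along a word. *)
Record close_action rho rho' Lam D (mu eps : R) : Prop := CloseAction {
  close_contract : forall i p z w, Lam p -> ball p (delta D) `<=` cov D i ->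
    ball (rho (gen D i)^-1%g p) (delta D) z ->
    ball (rho (gen D i)^-1%g p) (delta D) w ->
    mdist (rho' (gen D i) z) (rho' (gen D i) w) <= mu * mdist z w;
  close_center : forall i p, Lam p ->
    mdist p (rho' (gen D i) (rho (gen D i)^-1%g p)) <= eps;
  close_drift : forall i p z, Lam p -> ball p (delta D) z ->
    mdist (rho (gen D i)^-1%g p) (rho' (gen D i)^-1%g z)
      <= Lcst D * mdist p z + eps
}.

(** Expansion can be inverted only for points coming from [cov D i]. The inclusion in
    [expanding_within], taken at radius [delta D], provides this, since the ball of radius
    [lambda D * delta D] contains the one of radius [delta D]. *)
Lemma expansion_inverse_contracts rho Lam D i p z w :
  expansion_datum rho Lam D -> ball p (delta D) `<=` cov D i ->
  ball (rho (gen D i)^-1%g p) (delta D) z ->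
  ball (rho (gen D i)^-1%g p) (delta D) w ->
  mdist (rho (gen D i) z) (rho (gen D i) w) <= (lambda D)^-1 * mdist z w.
Proof.
move=> ED pU; have [exp inc] := gen_expanding ED i.
have l1 := lambda_gt1 ED; have d0 := delta_gt0 ED.
have pre v : ball (rho (gen D i)^-1%g p) (delta D) v ->
    cov D i (rho (gen D i) v).
  move=> /ballP v1; have [|u /pU Uu <-] := inc _ _ pU (lexx _) v.
    by apply/ballP; nra.
  by rewrite actKV.
move=> /pre Uz /pre Uw; have := exp _ _ Uz Uw; rewrite !actK => h.
by rewrite ler_pdivlMl //; lra.
Qed.

Lemma close_actionP rho rho' Lam D K (eps : R) :
  expansion_datum rho Lam D -> invariant_set rho Lam ->
  Lam `<=` K -> nbhd (delta D) Lam `<=` K -> 0 < eps ->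
  (forall i, dLip K (rho (gen D i)) (rho' (gen D i)) < eps%:E)%E ->
  close_action rho rho' Lam D ((lambda D)^-1 + eps) eps.
Proof.
move=> ED inv LK NK eps0 hclose.
split=> [i p z w Lp pU pz pw|i p Lp|i p z Lp pz].
- have Lq := act_invariant (gen D i)^-1%g inv Lp.
  have Kz : K z by apply: NK; exists (rho (gen D i)^-1%g p).
  have Kw : K w by apply: NK; exists (rho (gen D i)^-1%g p).
  have [->|/eqP zw] := eqVneq z w; first by rewrite !mdistxx mulr0.
  have d0 : 0 < mdist z w by rewrite mdist_gt0; apply/eqP.
  have [_ /(_ z w Kz Kw zw)] := dLip_lt (hclose i).
  rewrite -mulrBl normrM normfV (gtr0_norm d0) ltr_pdivrMr // => h.
  have := expansion_inverse_contracts ED pU pz pw.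
  have := ler_norm (mdist (rho' (gen D i) z) (rho' (gen D i) w) -
    mdist (rho (gen D i) z) (rho (gen D i) w)).
  by rewrite distrC mulrDl; lra.
- have [/(_ (rho (gen D i)^-1%g p)) + _] := dLip_lt (hclose i).
  by rewrite actKV => h; apply/ltW/h/LK; exact: act_invariant.
(* By symmetry the inverse generator is itself a generator [gen D j], so closeness applies to it
   directly. *)
- have [|j _ gj] := gen_symmetric ED (g := gen D i); first by exists i.
  have Np : nbhd (delta D) Lam p.
    by exists p => //; apply/ballP; rewrite mdistxx; exact: delta_gt0 ED.
  have Nz : nbhd (delta D) Lam z by exists p.
  have [/(_ z (NK _ Nz)) + _] := dLip_lt (hclose j); rewrite gj => h.
  have := gen_lipschitz ED i Np Nz.
  have := metric_triangle (rho (gen D i)^-1%g p) (rho (gen D i)^-1%g z)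
    (rho' (gen D i)^-1%g z).
  by lra.
Qed.

End Perturbation.

(** * Existence, uniqueness and invariance of shadows *)

Section Shadowing.
Local Open Scope ring_scope.
Context {R : realType} {M : metricType R} {G : groupType}.
Context (rho rho' : lip_action M G) (Lam : set M) (D : datum M G).
Context (mu eps e : R).
Hypothesis hproper : proper_space M.
Hypothesis inv : invariant_set rho Lam.
Hypothesis close : close_action rho rho' Lam D mu eps.
Hypotheses (mu0 : 0 <= mu) (mu1 : mu < 1) (eps_mu : mu * e + eps <= e)
  (eps_ge0 : 0 <= eps) (e0 : 0 < e) (eD : e < delta D).
Implicit Types (x y z w p : M) (a : nat -> idx D) (c : nat -> G).

Definition shadows x c y : Prop :=
  forall k, mdist (rho (c k)^-1%g x) (rho' (c k)^-1%g y) <= e.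

(** The distance is at most [mu * t + eps], which is at most [t] for all [t >= e] because this holds
    at [e] and [mu < 1]. *)
Lemma close_gen_step i p z (t : R) : Lam p -> ball p (delta D) `<=` cov D i ->
  e <= t -> t < delta D -> mdist (rho (gen D i)^-1%g p) z <= t ->
  mdist p (rho' (gen D i) z) <= t.
Proof.
move=> Lp pU et tD zt.
have qz : ball (rho (gen D i)^-1%g p) (delta D) z.
  by apply/ballP; exact: le_lt_trans zt tD.
have qq : ball (rho (gen D i)^-1%g p) (delta D) (rho (gen D i)^-1%g p).
  by apply/ballP; rewrite mdistxx; apply: lt_trans e0 eD.
have := close_contract close Lp pU qq qz; have := close_center close i Lp.
have := metric_triangle p (rho' (gen D i) (rho (gen D i)^-1%g p))
  (rho' (gen D i) z).
have mut : 0 <= mu * (t - mdist (rho (gen D i)^-1%g p) z).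
  by rewrite mulr_ge0 // subr_ge0.
have mue : 0 <= (1 - mu) * (t - e).
  by rewrite mulr_ge0 // subr_ge0 // ltW.
by move: eps_mu; rewrite mulrBr in mut; lra.
Qed.

Section Code.
Context (x : M) (a : nat -> idx D).
Hypotheses (Lx : Lam x) (xa : is_code rho (delta D) x a).

Local Notation p := (code_pt rho x a).

Let Lp k : Lam (p k). Proof. exact: code_pt_invariant. Qed.

(** Only generators at times after [k] occur, where a code is constrained. *)
Lemma ray_pullback k n z (t : R) : (k <= n)%N -> e <= t -> t < delta D ->
  mdist (p n.+1) z <= t ->
  mdist (p k.+1) (rho' ((ray a k)^-1 * ray a n)%g z) <= t.
Proof.
move=> + et tD; elim: n z => [|n IH] z.
  by rewrite leqn0 => /eqP ->; rewrite mulVg act1.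
rewrite leq_eqVlt => /predU1P[->|kn] zt; first by rewrite mulVg act1.
rewrite rayS mulgA act_mul; apply: IH => //.
exact: close_gen_step (xa _) _ _ _.
Qed.

(** Cancelling [ray a 0] leaves the generators at times 1 to [n], each of which contracts by
    [mu]. *)
Lemma ray_contract n z w : ball (p n.+1) (delta D) z ->
  ball (p n.+1) (delta D) w ->
  mdist (rho' ((ray a 0)^-1 * ray a n)%g z) (rho' ((ray a 0)^-1 * ray a n)%g w)
    <= mu ^+ n * mdist z w.
Proof.
elim: n z w => [|n IH] z w; first by rewrite mulVg !act1 expr0 mul1r.
move=> zn wn; rewrite rayS mulgA (act_mul _ _ _ z) (act_mul _ _ _ w).
have step v : ball (p n.+2) (delta D) v ->
    ball (p n.+1) (delta D) (rho' (gen D (a n.+1)) v).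
  (* [close_gen_step] preserves only radii that are at least [e], hence the maximum. *)
  move=> /ballP vn; pose t := Num.max e (mdist (p n.+2) v).
  apply/ballP; apply: (@le_lt_trans _ _ t); last by rewrite gt_max eD.
  apply: close_gen_step (xa _) _ _ _ => //; rewrite ?le_max ?lexx ?orbT //.
  by rewrite gt_max eD.
apply: (le_trans (IH _ _ (step _ zn) (step _ wn))).
rewrite exprSr -mulrA ler_wpM2l ?exprn_ge0 //.
exact: (close_contract close (Lp n.+1) (@xa n.+1 isT)).
Qed.

Lemma shadow_ex : exists y, shadows x (ray a) y.
Proof.
(* [u n] carries the orbit point at time [n.+1] back to time 1. The sequence stays in a closed
   [e]-ball, compact by properness; a cluster point moved by [ray a 0] is the shadow. *)
pose u n := rho' ((ray a 0)^-1 * ray a n)%g (p n.+1).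
have [|z [_ clz]] := @hproper (p 1%N) e (u @ \oo) _.
  exists 0%N => // n _ /=; apply: ray_pullback => //.
  by rewrite mdistxx ltW.
exists (rho' (ray a 0) z) => k; rewrite -code_ptS -act_mul.
(* For [n >= k] the point [u n] satisfies this condition, which passes to the cluster point because
   it is closed. *)
have cl : closed
    [set v | mdist (p k.+1) (rho' ((ray a k)^-1 * ray a 0)%g v) <= e].
  apply: (@closed_comp _ _ _ [set v | mdist (p k.+1) v <= e]).
    by move=> ? _; exact: act_continuous.
  exact: closed_mdist_ball.
apply: cl; rewrite closureEcluster; apply: cvg_cluster clz.
move=> B hB; exists k => // n kn; apply: hB => /=.
rewrite /u -act_mul mulgA mulgK; apply: ray_pullback => //.
by rewrite mdistxx ltW.
Qed.

(** Serves both uniqueness, with [n] arbitrarily large, and continuity, with one fixed [n]. *)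
Lemma ray_dist_le n y z :
  ball (p n.+1) (delta D) (rho' (ray a n)^-1%g y) ->
  ball (p n.+1) (delta D) (rho' (ray a n)^-1%g z) ->
  mdist (rho' (ray a 0)^-1%g y) (rho' (ray a 0)^-1%g z)
    <= mu ^+ n * (delta D *+ 2).
Proof.
move=> yn zn; have := ray_contract yn zn; rewrite -!act_mul mulgK => h.
apply: (le_trans h); rewrite ler_wpM2l ?exprn_ge0 //.
move/ballP: yn; move/ballP: zn => zn yn; rewrite mulr2n.
have := metric_triangle (rho' (ray a n)^-1%g y) (p n.+1)
  (rho' (ray a n)^-1%g z).
by rewrite (metric_sym _ (p n.+1)); lra.
Qed.

Lemma shadow_uniq y z (P : set nat) : shadows x (ray a) y -> infinite_set P ->
  (forall k, P k ->
     mdist (rho (ray a k)^-1%g x) (rho' (ray a k)^-1%g z) < delta D) ->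
  y = z.
Proof.
move=> sh infP hz; apply: (@act_inj _ _ _ rho' (ray a 0)^-1%g).
apply: contrapT => /eqP; rewrite -mdist_gt0 => d0.
have [n0 hn0] := expr_small (delta D *+ 2) mu0 mu1 d0.
have [k Pk nk] := infinite_set_ge n0 infP.
have := hn0 k nk; apply/negP; rewrite -leNgt; apply: ray_dist_le.
  by apply/ballP; rewrite code_ptS; apply: le_lt_trans (sh k) eD.
by apply/ballP; rewrite code_ptS; exact: hz.
Qed.

End Code.

(** One letter turns an error [t] into at most [Lcst D * t + eps <= t * (Lcst D + 1)]. The bound on
    the final error also keeps all intermediate ones below [delta D], as [close_drift] requires. *)
Lemma word_drift (w : seq G) p z (t : R) : {in w, forall s, range (gen D) s} ->
  Lam p -> 0 <= Lcst D -> eps <= t -> t * (Lcst D + 1) ^+ size w < delta D ->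
  mdist p z <= t ->
  mdist (rho (\prod_(s <- w) s)^-1%g p) (rho' (\prod_(s <- w) s)^-1%g z)
    <= t * (Lcst D + 1) ^+ size w.
Proof.
move=> + + L0; elim: w p z t => [|s w IH] p z t hw Lp et tw pz.
  by rewrite big_nil invg1 !act1 expr0 mulr1.
have [i _ si] : range (gen D) s by apply: hw; rewrite inE eqxx.
have tL : t * (Lcst D + 1) ^+ size (s :: w) =
    t * (Lcst D + 1) * (Lcst D + 1) ^+ size w by rewrite exprS mulrA.
rewrite big_cons invgM !act_mul tL; rewrite tL in tw.
have tD : t < delta D.
  apply: le_lt_trans tw; rewrite -mulrA ler_peMr ?(le_trans eps_ge0) //.
  by rewrite -exprS exprn_ege1 // lerDr.
apply: IH => //.
- by move=> r rw; apply: hw; rewrite inE rw orbT.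
- exact: act_invariant.
- by apply: (le_trans et); rewrite ler_peMr ?(le_trans eps_ge0) // lerDr.
- have := close_drift close i Lp (z := z); rewrite si => /(_ _)/le_trans; apply.
    by apply/ballP; apply: le_lt_trans pz tD.
  by have := ler_wpM2l L0 pz; lra.
Qed.

Context (N : nat).
Hypotheses (L0 : 0 <= Lcst D) (eps_e : eps <= e)
  (eN : e * (Lcst D + 1) ^+ N < delta D).

Lemma shadow_ray_close x c c' y : Lam x ->
  ray_close rho D (delta D) N x c c' -> shadows x c y -> shadows x c' y.
Proof.
move=> Lx [_ [a' xa' <-] [P [Q [_ infQ /hausdorff_dist_word hPQ]]]] sh.
have [y' sh'] := shadow_ex Lx xa'; suff <- : y' = y by [].
apply: (shadow_uniq Lx xa' sh' infQ) => j /hPQ[k [w [_ hw sw ->]]].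
have ew : e * (Lcst D + 1) ^+ size w <= e * (Lcst D + 1) ^+ N.
  by rewrite ler_wpM2l ?(ltW e0) // ler_weXn2l // lerDr.
have eD' := le_lt_trans ew eN.
rewrite invgM !act_mul; apply: le_lt_trans eD'.
by apply: word_drift => //; [exact: act_invariant|exact: le_lt_trans ew eN].
Qed.

(** An equivalence is proved so that symmetric closure is immediate. Backwards along one step, the
    shadow of [c] also shadows [c'], and uniqueness along [c'] identifies it with [y]. *)
Lemma shadow_ray_equiv x c c' : Lam x -> ray_equiv rho D (delta D) N x c c' ->
  forall y, shadows x c y <-> shadows x c' y.
Proof.
move=> Lx; elim=> {c c'} [c c' cc' y|//|c c' _ h y|c1 c2 c3 _ h12 _ h23 y].
- split=> [|sh']; first exact: shadow_ray_close.
  have [[a xa ac] [a' xa' ac'] _] := cc'; have [y1 sh1] := shadow_ex Lx xa.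
  rewrite ac in sh1; have := shadow_ray_close Lx cc' sh1; rewrite -ac' => sh2.
  suff <- : y1 = y by [].
  apply: (shadow_uniq Lx xa' sh2 infinite_nat) => k _.
  by apply: le_lt_trans eD; rewrite ac'; exact: sh'.
- by split=> /h.
- by split=> [/h12/h23|/h23/h12].
Qed.

End Shadowing.

(** * Rays under refinement, expansivity, and inverses on compact sets *)

Section Conjugacy.
Local Open Scope ring_scope.
Context {R : realType} {M : metricType R} {G : groupType}.
Implicit Types (rho : lip_action M G) (Lam : set M) (D : datum M G).

Lemma refinement_Ray rho D0 D x : refinement D0 D ->
  Ray rho D0 (delta D0) x `<=` Ray rho D (delta D) x.
Proof.
move=> [[io _ hio] [dD _ _]] _ [a xa <-]; exists (io \o a); last first.
  by apply/funext => k; apply: eq_bigr => j _; have [_ ->] := hio (a j).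
have pt k : code_pt rho x (io \o a) k = code_pt rho x a k.
  by elim: k => //= k ->; have [_ ->] := hio (a k).
move=> k k0 y /ballP; rewrite pt => xy; have [UU _] := hio (a k).
by apply/UU/(xa _ k0)/ballP; exact: lt_trans dD.
Qed.

(** Applying at each step a generator that expands near the current point bounds the distance by
    [delta D] times arbitrarily high powers of [(lambda D)^-1]. *)
Lemma expansive rho Lam D x y : expansion_datum rho Lam D ->
  invariant_set rho Lam -> Lam x -> Lam y ->
  (forall g, mdist (rho g x) (rho g y) < delta D) -> x = y.
Proof.
move=> ED inv Lx Ly xy; apply: contrapT => /eqP; rewrite -mdist_gt0 => d0.
have l1 := lambda_gt1 ED; have l0 : 0 < lambda D by lra.
have grow n : forall u v, Lam u -> Lam v ->
    (forall g, mdist (rho g u) (rho g v) < delta D) ->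
    mdist u v <= (lambda D)^-1 ^+ n * delta D.
  elim: n => [|n IH] u v Lu Lv uv.
    by have := uv 1%g; rewrite !act1 expr0 mul1r => /ltW.
  have [i hi] := expansion_datum_cover ED Lu.
  have [exp _] := gen_expanding ED i.
  rewrite exprS -mulrA ler_pdivlMl //; apply: le_trans (exp u v _ _) _.
  - by apply/hi/ballP; rewrite mdistxx; exact: delta_gt0 ED.
  - by apply/hi/ballP; have := uv 1%g; rewrite !act1.
  - apply: IH; [exact: act_invariant|exact: act_invariant|move=> g].
    by rewrite -!act_mul.
have [||n /(_ n (leqnn _))] := @expr_small R (lambda D)^-1 (delta D) _ _ _ d0.
- by rewrite invr_ge0 ltW.
- by rewrite invf_lt1.
by apply/negP; rewrite -leNgt; exact: grow.
Qed.

(** The part of [A] outside the interior of [B] is compact, so its image is closed; the image misses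
    [f x], and its complement is the required neighborhood. *)
Lemma compact_inverse_continuous (T U : topologicalType) (A : set T)
    (f : T -> U) (g : U -> T) : hausdorff_space U -> compact A ->
  {within A, continuous f} -> {in A, cancel f g} ->
  {within f @` A, continuous g}.
Proof.
move=> hU cA cf fK; apply/subspace_continuousP => _ [x Ax <-].
rewrite /from_subspace fK ?inE // => B /= xB.
have cC : compact (A `&` ~` B°).
  by apply: compact_closedI => //; apply: open_closedC; exact: open_interior.
have clC : closed (f @` (A `&` ~` B°)).
  apply: compact_closed hU _.
  by apply: continuous_compact cC; apply: continuous_subspaceW cf => ? [].
have : nbhs (f x) (~` (f @` (A `&` ~` B°))).
  apply: open_nbhs_nbhs; split; first exact: closed_openC.
  by move=> [y [Ay By] /(congr1 g)]; rewrite !fK ?inE // => yx;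
    rewrite yx in By.
rewrite nbhs_simpl /within /=; apply: filterS => u nC [y Ay yu].
rewrite -yu in nC *; rewrite /= fK ?inE //.
by apply: interior_subset; apply: contrapT => By; apply: nC; exists y.
Qed.

End Conjugacy.

(** * The shadow map as a conjugacy *)

Section Stability.
Local Open Scope ring_scope.
Context {R : realType} {M : metricType R} {G : groupType}.
Context (rho rho' : lip_action M G) (Lam : set M) (D0 D : datum M G).
Context (mu eps e : R) (N : nat).
Hypothesis hproper : proper_space M.
Hypothesis cLam : compact Lam.
Hypothesis inv : invariant_set rho Lam.
Hypotheses (ED0 : expansion_datum rho Lam D0) (ED : expansion_datum rho Lam D)
  (D0D : refinement D0 D).
Hypothesis meander : forall x, Lam x -> forall c c',
  Ray rho D0 (delta D0) x c -> Ray rho D0 (delta D0) x c' ->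
  ray_equiv rho D (delta D) N x c c'.
Hypothesis close : close_action rho rho' Lam D mu eps.
Hypotheses (mu0 : 0 <= mu) (mu1 : mu < 1) (eps_mu : mu * e + eps <= e)
  (eps_ge0 : 0 <= eps) (eps_e : eps <= e) (e0 : 0 < e) (eD : e *+ 2 < delta D)
  (eN : e * (Lcst D + 1) ^+ N < delta D).

Let e_lt_delta : e < delta D.
Proof. by apply: le_lt_trans eD; rewrite mulr2n lerDl ltW. Qed.

(** Codes are taken in [D0], where meandering hyperbolicity applies, while shadows and ray
    equivalence live in [D]; refinement converts the rays. *)
Lemma shadow_map_ex : exists phi : M -> M, forall x, Lam x -> forall c,
  Ray rho D0 (delta D0) x c -> shadows rho rho' e x c (phi x).
Proof.
suff /choice[phi hphi] : forall x, exists y, Lam x -> forall c,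
    Ray rho D0 (delta D0) x c -> shadows rho rho' e x c y by exists phi.
move=> x.
have [Lx|] := pselect (Lam x); last by exists x.
have [a xa] := full_code_exists ED0 inv Lx.
have xr : Ray rho D0 (delta D0) x (ray a) by exists a => // k _; exact: xa.
have [a' xa' aa'] := refinement_Ray D0D xr.
have [y] := shadow_ex hproper inv close mu0 mu1 eps_mu e0 e_lt_delta Lx xa'.
rewrite aa' => sh.
exists y => _ c xc.
have L0 : 0 <= Lcst D by have := lambda_gt1 ED; have := lambda_leL ED; lra.
exact/(shadow_ray_equiv hproper inv close mu0 mu1 eps_mu eps_ge0 e0 e_lt_delta
  L0 eps_e eN Lx (meander Lx xr xc)).
Qed.

Context (phi : M -> M).
Hypothesis phi_shadows : forall x, Lam x -> forall c,
  Ray rho D0 (delta D0) x c -> shadows rho rho' e x c (phi x).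

Lemma shadow_map_eq x z a (P : set nat) : Lam x ->
  is_code rho (D := D0) (delta D0) x a -> infinite_set P ->
  (forall k, P k ->
     mdist (rho (ray a k)^-1%g x) (rho' (ray a k)^-1%g z) < delta D) ->
  phi x = z.
Proof.
move=> Lx xa infP hz; have xr : Ray rho D0 (delta D0) x (ray a) by exists a.
have [a' xa' aa'] := refinement_Ray D0D xr.
have sh := phi_shadows Lx xr; rewrite -aa' in sh hz.
exact: (shadow_uniq inv close mu0 mu1 eps_mu e0 e_lt_delta Lx xa' sh infP hz).
Qed.

(* The code of [rho (gen D0 i) x] is that of [x] with [i] prepended; this is
   why no condition is put on a code at time 0. *)
Lemma shadow_map_gen i x : Lam x ->
  rho' (gen D0 i) (phi x) = phi (rho (gen D0 i) x).
Proof.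
move=> Lx; have [b xb] := full_code_exists ED0 inv Lx.
pose a k := if k is j.+1 then b j else i.
have pt k : code_pt rho (rho (gen D0 i) x) a k.+1 = code_pt rho x b k.
  by elim: k => [|k IH]; [rewrite /= actK|rewrite [RHS]/= -IH].
have ra k : ray a k.+1 = (gen D0 i * ray b k)%g.
  by rewrite /ray big_ord_recl.
(* Time 0 is discarded because [ra] describes only the elements [ray a k.+1]. *)
apply/esym/(@shadow_map_eq _ _ a [set k | (0 < k)%N]).
- exact: act_invariant.
- by case=> // k _; rewrite pt; exact: xb.
- move=> fin; apply: infinite_nat; rewrite -(setUv [set 0%N]) finite_setU.
  split; first exact: finite_set1.
  by apply: sub_finite_set fin => k /eqP; rewrite /= lt0n.
- case=> // k _; rewrite ra invgM !act_mul !actK.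
  apply: le_lt_trans e_lt_delta; apply: (phi_shadows Lx).
  by exists b => // j _; exact: xb.
Qed.

(** The elements intertwined by [phi] form a subgroup containing the generators of [D0]. *)
Lemma shadow_map_equivariant g x : Lam x -> rho' g (phi x) = phi (rho g x).
Proof.
pose H : set G :=
  [set h | forall u, Lam u -> rho' h (phi u) = phi (rho h u)].
suff HT : H = setT by have Hg : H g; [rewrite HT|exact: Hg].
apply: (gen_generating ED0); last by move=> _ [i _ <-] u; exact: shadow_map_gen.
split=> [u _|h k Hh Hk u Lu|h Hh u Lu]; first by rewrite !act1.
  by rewrite !act_mul Hk // Hh //; exact: act_invariant.
by rewrite -{1}(actKV rho h u) -Hh ?actK //; exact: act_invariant.
Qed.

(** Shadowing compares points only after applying some [(c k)^-1]. It is therefore used at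
    [rho (ray a 0) x], whose code [b] prepends [a 0] to [a], and equivariance brings the estimate
    back to [x]. *)
Lemma shadow_map_near x : Lam x -> mdist x (phi x) <= e.
Proof.
move=> Lx; have [a xa] := full_code_exists ED0 inv Lx.
have Ly := act_invariant (ray a 0) inv Lx.
pose b k := if k is j.+1 then a j else a 0%N.
have r0 : ray b 0 = ray a 0 by rewrite !ray0.
have yb : is_code rho (D := D0) (delta D0) (rho (ray a 0) x) b.
  case=> // k _.
  suff -> : code_pt rho (rho (ray a 0) x) b k.+1 = code_pt rho x a k.
    exact: xa.
  by elim: k => [|k IH]; [rewrite /= ray0 actK|rewrite [RHS]/= -IH].
have /(_ 0%N) := phi_shadows Ly (ex_intro2 _ _ b yb erefl).
by rewrite r0 shadow_map_equivariant // !actK.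
Qed.

Lemma shadow_map_inj : {in Lam &, injective phi}.
Proof.
move=> x y; rewrite !inE => Lx Ly xy; apply: (expansive ED inv) => // g.
have Lgx := act_invariant g inv Lx; have Lgy := act_invariant g inv Ly.
have := shadow_map_near Lgx; have := shadow_map_near Lgy.
rewrite -!shadow_map_equivariant // xy (metric_sym (rho g y)) => ye xe.
(* Both orbit points are [e]-close to [rho' g (phi y)], whence the constant [e *+ 2]. *)
apply: le_lt_trans eD; rewrite mulr2n.
exact: le_trans (metric_triangle _ (rho' g (phi y)) _) (lerD xe ye).
Qed.

(** For fixed [n], points [y] near [x] have [rho (ray a n)^-1 y] within [delta D - e] of the image
    of [x]. Equivariance and [shadow_map_near] then put [rho' (ray a n)^-1 (phi y)] in the
    [delta D]-ball, and the contraction by [mu ^+ n] applies. *)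
Lemma shadow_map_continuous : {within Lam, continuous phi}.
Proof.
apply/subspace_continuousP => x Lx.
have [a xa] := full_code_exists ED0 inv Lx.
have xr : Ray rho D0 (delta D0) x (ray a) by exists a => // k _; exact: xa.
have [a' xa' aa'] := refinement_Ray D0D xr.
(* The contraction is measured after [rho' (ray a 0)^-1], which is then undone by continuity of
   [rho' (ray a 0)]. *)
suff h : rho' (ray a 0)^-1%g \o phi @ within Lam (nbhs x) -->
    rho' (ray a 0)^-1%g (phi x).
  have := cvg_comp _ _ h (@act_continuous _ _ _ rho' (ray a 0) _).
  rewrite actKV (_ : rho' (ray a 0) \o _ = phi) //.
  by apply/funext => y; rewrite /= actKV.
apply/metricType_numDomainType.cvgrPdist_lt => r r0.
have [n /(_ n (leqnn _)) hn] := expr_small (delta D *+ 2) mu0 mu1 r0.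
have xyn : \forall y \near within Lam (nbhs x),
    mdist (rho (ray a n)^-1%g x) (rho (ray a n)^-1%g y) < delta D - e.
  apply: metricType_numDomainType.cvgr_dist_lt; last by rewrite subr_gt0.
  by apply: cvg_within_filter; exact: act_continuous.
near=> y; have Ly : Lam y by near: y; exact: withinT.
apply: le_lt_trans hn.
rewrite -aa'.
apply: (ray_dist_le inv close mu0 mu1 eps_mu e0 e_lt_delta Lx xa').
  apply/ballP; rewrite code_ptS aa'; apply: le_lt_trans e_lt_delta.
  exact: phi_shadows.
apply/ballP; rewrite code_ptS aa' shadow_map_equivariant //.
have Lny := act_invariant (ray a n)^-1%g inv Ly.
apply: le_lt_trans (metric_triangle _ (rho (ray a n)^-1%g y) _) _.
rewrite -ltrBrDr; apply: (@lt_le_trans _ _ (delta D - e)); last first.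
  by rewrite lerD2l lerN2; exact: shadow_map_near.
by near: y.
Unshelve. all: by end_near. Qed.

Lemma shadow_map_conjugates : exists Lam' (f : M -> M),
  [/\ invariant_set rho' Lam', homeomorphism_between Lam Lam' f &
    forall g x, Lam x -> rho' g (f x) = f (rho g x)].
Proof.
exists (phi @` Lam), phi; split; last exact: shadow_map_equivariant.
- move=> g; apply/seteqP; split=> [_ [_ [x Lx <-] <-]|_ [x Lx <-]].
    rewrite shadow_map_equivariant //; exists (rho g x) => //.
    exact: act_invariant.
  have Lgx := act_invariant g^-1%g inv Lx.
  exists (phi (rho g^-1%g x)); first by exists (rho g^-1%g x).
  by rewrite shadow_map_equivariant // actKV.
(* The inverse [h] takes the default value [y] off the image of [phi]. *)
- have /choice[h hh] : forall y, exists x,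
      forall x', Lam x' -> phi x' = y -> x = x'.
    move=> y; have [[x Lx <-]|ny] := pselect ((phi @` Lam) y).
      by exists x => x' Lx' /esym; apply: shadow_map_inj; rewrite inE.
    by exists y => x' Lx' xy; case: ny; exists x'.
  have hK : {in Lam, cancel phi h} by move=> x; rewrite inE => Lx; exact: hh.
  split; [by split=> [x Lx|x y|//]; [exists x|exact: shadow_map_inj]|
          exact: shadow_map_continuous|exists h; split=> //].
  apply: compact_inverse_continuous hK => //; first exact: metric_hausdorff.
  exact: shadow_map_continuous.
Qed.

End Stability.

(** * Choice of the constants and conclusion *)

Theorem theorem1p1 (R : realType) (M : metricType R) (G : groupType)
    (hproper : proper_space M) (hgeod : geodesic_space M)
    (hfg : finitely_generated G)
    (rho : lip_action M G) (Lam : set M)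
    (hne : Lam !=set0) (hcompact : compact Lam)
    (hinv : invariant_set rho Lam)
    (hiso : forall x, Lam x -> ~ isolated [set: M] x)
    (D : datum M G) (hmh : meandering_hyperbolic_wrt rho Lam D) :
  structurally_stable_wrt rho Lam D.
Proof.
have [D0 [ED0 ED D0D [N _ meander]]] := hmh.
have l1 := lambda_gt1 ED; have lL := lambda_leL ED; have d0 := delta_gt0 ED.
have l0 : (0 < lambda D)%R by apply: lt_trans l1.
have [K cK [LK NK]] := nbhd_sub_compact (delta D) hproper hne hcompact.
have li0 : (0 < (lambda D)^-1)%R by rewrite invr_gt0.
have li1 : ((lambda D)^-1 < 1)%R by rewrite invf_lt1.
pose B := ((Lcst D + 1) ^+ N)%R.
have B1 : (1 <= B)%R by rewrite exprn_ege1 //; lra.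
(* [B] is the growth of errors over a word of length [N]. This [e] satisfies [e < 1] and
   [3 * e * B < delta D]; as [1 <= B], both [e * B] and [e *+ 2] are below [delta D]. *)
pose e := (delta D / (delta D + 3 * B))%R.
have den : (0 < delta D + 3 * B)%R by lra.
have e0 : (0 < e)%R by rewrite divr_gt0.
have eden : (e * (delta D + 3 * B) = delta D)%R by rewrite divfK // gt_eqF.
(* Since [e < 1], the factor [mu = (lambda D)^-1 + eps] is at most [(1 + (lambda D)^-1) / 2 < 1],
   and [mu * e + eps <= e] follows. *)
pose eps := ((1 - (lambda D)^-1) / 2 * e)%R.
have e1 : (e < 1)%R by nra.
have eps0 : (0 < eps)%R by rewrite mulr_gt0 //; lra.
exists K, eps; split=> // rho' rho'_close.
have close := close_actionP ED hinv LK NK eps0 rho'_close.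
have eps_small : (eps <= (1 - (lambda D)^-1) / 2)%R by rewrite /eps; nra.
have mu0 : (0 <= (lambda D)^-1 + eps)%R by lra.
have mu1 : ((lambda D)^-1 + eps < 1)%R by lra.
have eps_mu : (((lambda D)^-1 + eps) * e + eps <= e)%R.
  have := ler_wpM2r (ltW e0) eps_small; rewrite /eps; nra.
have eps_e : (eps <= e)%R by rewrite /eps; nra.
have eB : (e <= e * B)%R by rewrite ler_peMr // ltW.
have eN : (e * B < delta D)%R by nra.
have eD : (e *+ 2 < delta D)%R by rewrite mulr2n; nra.
have [phi hphi] := shadow_map_ex hproper hinv ED0 ED D0D meander close mu0 mu1
  eps_mu (ltW eps0) eps_e e0 eD eN.
exact: (shadow_map_conjugates hcompact hinv ED0 ED D0D close mu0 mu1
  eps_mu e0 eD hphi).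
Qed.
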